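(* Let $k>1$ and $\Delta\ge1$. Any linear sparse recovery scheme with approximation factor $K$ with respect to $\mathrm{EMD}$ over the interval $[\Delta]$ requires $$m\ge\frac{\Omega(k)\log\left(\Omega\left(\log\frac{\Delta}{k}\right)\right)}{\log K}$$ measurements.
   Context: $[\Delta]=\{1,\dots,\Delta\}$. For non-negative measures $x,y$ on $[\Delta]$ of equal total mass, $\mathrm{EMD}(x,y)$ is the minimum cost of transporting $x$ to $y$, where moving mass $w$ from $a$ to $b$ costs $w|a-b|$. A linear sparse recovery scheme with $m$ measurements and approximation factor $K$ is a probability distribution over pairs $(A,\mathcal{A})$ with $A\in\mathbb{R}^{m\times\Delta}$ and $\mathcal{A}:\mathbb{R}^m\to\mathbb{R}^{\Delta}$ such that, for every non-negative input $x$, with probability at least $3/4$ the output $\widehat x=\mathcal{A}(Ax)$ satisfies $\mathrm{EMD}(\widehat x,x)\le K\cdot\min_{k\text{-sparse } x'}\mathrm{EMD}(x,x')$, the minimum being over non-negative $x'$ with at most $k$ nonzero entries and the same total mass as $x$.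
   Formalization: The constants in Ω are uniform for K ≥ K0, with any K0 > 1 fixed first (absolute constants for all K > 1 fail: exact recovery with m = Δ as K → 1), and the success of the random scheme is assumed to be an event jointly measurable in the scheme's randomness and the input x. *)

(* Defs.v *)
(* MathComp / MathComp-Analysis. *)
From HB Require Import structures.
From mathcomp Require Import all_boot all_order all_algebra.
From mathcomp Require Import all_classical all_reals all_analysis.
Set Implicit Arguments.
Unset Strict Implicit.
Unset Printing Implicit Defensive.
Import Order.TTheory GRing.Theory Num.Theory.
Local Open Scope classical_set_scope.
Local Open Scope ring_scope.

(* The points of the interval [Delta] are indexed from 0, which does not affect
   the distances |a - b|. Vectors on [Delta] are column vectors. *)

Definition nonneg_vec (R : realType) (Delta : nat) (x : 'cV[R]_Delta) : Prop :=
  forall a, 0 <= x a ord0.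

Definition mass (R : realType) (Delta : nat) (x : 'cV[R]_Delta) : R :=
  \sum_(a < Delta) x a ord0.

Definition sparse (R : realType) (Delta k : nat) (x : 'cV[R]_Delta) : Prop :=
  (#|[pred a : 'I_Delta | x a ord0 != 0%R]| <= k)%N.

Definition transport_plan (R : realType) (Delta : nat) (x y : 'cV[R]_Delta)
    (g : 'M[R]_Delta) : Prop :=
  [/\ forall a b, 0 <= g a b,
      forall a, \sum_(b < Delta) g a b = x a ord0
    & forall b, \sum_(a < Delta) g a b = y b ord0].

Definition transport_cost (R : realType) (Delta : nat) (g : 'M[R]_Delta) : R :=
  \sum_(a < Delta) \sum_(b < Delta)
    g a b * `|(nat_of_ord a)%:R - (nat_of_ord b)%:R|.

(* The infimum is attained whenever a plan exists, i.e. exactly when x and y are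
   non-negative with equal mass; for all other pairs the set of costs is empty
   and EMD x y = +oo. *)
Definition EMD (R : realType) (Delta : nat) (x y : 'cV[R]_Delta) : \bar R :=
  ereal_inf [set (transport_cost g)%:E | g in transport_plan x y].

(* For x non-negative, 0 < k and 0 < Delta this infimum is finite and attained. *)
Definition best_sparse_error (R : realType) (Delta k : nat)
    (x : 'cV[R]_Delta) : \bar R :=
  ereal_inf [set EMD x x' | x' in
    [set x' : 'cV[R]_Delta | [/\ nonneg_vec x', sparse k x' & mass x' = mass x]]].

(* In particular an output xhat that has a negative entry or the wrong mass is
   a failure on every non-negative x, since then EMD xhat x = +oo. *)
Definition good_recovery (R : realType) (Delta k : nat) (K : R)
    (x xhat : 'cV[R]_Delta) : Prop :=
  (EMD xhat x <= K%:E * best_sparse_error k x)%E.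

(* The distribution over pairs is the law of the random pair (A w, rec w), w
   drawn from P. The first clause says that success is an event jointly in w and
   in the input x (Borel, in coordinates): this is implied by measurability of A
   and joint measurability of (w, y) |-> rec w y. Some such condition is needed:
   if only the events at fixed x are required to be measurable, the continuum
   hypothesis yields schemes with m = 1 that recover each x almost surely. *)
Definition linear_sparse_recovery_scheme (R : realType) (Delta k m : nat) (K : R)
    (d : measure_display) (T : measurableType d) (P : probability T R)
    (A : T -> 'M[R]_(m, Delta)) (rec : T -> 'cV[R]_m -> 'cV[R]_Delta) : Prop :=
  measurable [set wx : T * Delta.-tuple R |
    let x : 'cV[R]_Delta := \col_a tnth wx.2 a in
    good_recovery k K x (rec wx.1 (A wx.1 *m x))]
  /\ forall x : 'cV[R]_Delta, nonneg_vec x ->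
       ((3 / 4)%:E <= P [set w | good_recovery k K x (rec w (A w *m x))])%E.

(* Main.v *)
Require Import Defs.
From HB Require Import structures.
From mathcomp Require Import all_boot all_order all_algebra.
From mathcomp Require Import all_classical all_reals all_analysis.
From mathcomp Require Import measurable_realfun.
From mathcomp Require Import zify ring lra.
Import Order.TTheory GRing.Theory Num.Theory.
Local Open Scope ring_scope.
Set Implicit Arguments.
Unset Strict Implicit.
Unset Printing Implicit Defensive.

(** Cut [Delta] into h = k/2 blocks of length 2^(q+1), with q of order
    log (Delta/k). A symbol s picks in each block b one of the positions
    2^(s_b+1) and puts the mass 2^-(s_b+1) there, so that moving any spike to the
    origin of its block costs 1. The inputs are
      x = y(s_0) + delta y(s_1) + delta^2 y(s_2) + ... + delta^r eta u,
    with u uniform in the unit cube and delta of order 1/K. Sending everything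
    but y(s_0) to the block origins gives a k-sparse vector at distance
    O(delta h), so a successful recovery reveals s_0 up to few blocks; by
    linearity, once s_0 is known the measurements of the rest are known too and
    s_1 can be decoded, and so on. A decoder of this kind that is right about
    most symbols is so for few strings per measurement vector. On the other hand,
    the measurements of x only depend on a translate of u inside a box whose
    sides have length O(delta^-r) in at most m directions and 1 in the others.
    Comparing volumes bounds the number of strings by (O(1) delta^-r)^m times the
    multiplicity, and r -> oo gives q^h <= 16^h (40 K)^(4m). *)

(** * Sparse preimages *)

(* Maximality of the minor bounds the coefficients by Cramer's rule. *)
Lemma row_free_max_minor (R : realFieldType) (r n : nat) (A : 'M[R]_(r, n)) :
  row_free A ->
  exists f : 'I_r -> 'I_n, colsub f A \in unitmx /\
    forall i j, `|(invmx (colsub f A) *m A) i j| <= 1.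
Proof.
move=> fA.
have fAT : row_full A^T by rewrite /row_full mxrank_tr.
pose f0 : {ffun 'I_r -> 'I_n} := finfun (fullrankfun fAT).
have colT (f : 'I_r -> 'I_n) : colsub f A = (rowsub f A^T)^T.
  by apply/matrixP => i j; rewrite !mxE.
have [f _ fmax] := @arg_maxP _ _ _ f0 predT
  (fun f : {ffun 'I_r -> 'I_n} => `|\det (colsub f A)|) isT.
have uf : colsub f A \in unitmx.
  rewrite unitmxE unitfE -normr_gt0; apply: lt_le_trans (fmax f0 isT).
  rewrite normr_gt0 -unitfE -unitmxE colT unitmx_tr -row_full_unit.
  have -> : rowsub f0 A^T = rowsub (fullrankfun fAT) A^T.
    by apply/matrixP => i j; rewrite !mxE ffunE.
  exact: fullrowsub_full.
exists f; split=> // i j.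
rewrite /invmx uf -scalemxAl mxE normrM normfV.
have dgt : 0 < `|\det (colsub f A)| by rewrite normr_gt0 -unitfE -unitmxE.
rewrite mulrC ler_pdivrMr // mul1r.
(* Cramer: expanding along column [i], whose cofactors ignore that column, the entry is the
   determinant obtained by replacing [f i] with [j], so maximality of [f] applies. *)
pose g : {ffun 'I_r -> 'I_n} := [ffun l => if l == i then j else f l].
suff -> : (\adj (colsub f A) *m A) i j = \det (colsub g A) by apply: fmax.
rewrite mxE (expand_det_col _ i); apply: eq_bigr => l _.
rewrite !mxE ffunE eqxx mulrC; congr (_ * _).
rewrite /cofactor; congr (_ * \det _).
by apply/matrixP => a b; rewrite !mxE ffunE eq_sym (negbTE (neq_lift _ _)).
Qed.

(** Solve on the columns of a maximal minor of a row base, where all coefficients are at most 1 in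
    absolute value. One support [I] serves every [x]; this later confines all translations to the
    same [m] directions at most. *)
Lemma bounded_sparse_preimage (R : realFieldType) (m n : nat) (A : 'M[R]_(m, n)) :
  exists2 I : {set 'I_n}, (#|I| <= m)%N &
    forall x : 'cV[R]_n, exists t : 'cV[R]_n,
      [/\ A *m t = A *m x, forall a, a \notin I -> t a ord0 = 0
        & forall a, `|t a ord0| <= \sum_b `|x b ord0| ].
Proof.
have [f [uf fle]] := row_free_max_minor (row_base_free A).
set B := row_base A in uf fle.
have [C AE] : exists C, A = C *m B by apply/submxP; rewrite eq_row_base.
clearbody B.
exists [set f i | i in 'I_(\rank A)].
  by rewrite (leq_trans (leq_imset_card _ _)) // card_ord rank_leq_row.
move=> x; pose z := invmx (colsub f B) *m B *m x.
have injf : injective f.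
  move=> i j eqf; apply: contraTeq uf => ij.
  rewrite unitmxE unitfE negbK -det_tr.
  apply/eqP; apply: (determinant_alternate ij) => l; rewrite !mxE.
  by rewrite eqf.
(* As [f] is injective, each sum has at most one term: this places [z] on the image of [f] and 0
   elsewhere. *)
pose t : 'cV[R]_n := \col_a \sum_(i | f i == a) z i ord0.
have tE a : t a ord0 = \sum_(i | f i == a) z i ord0 by rewrite mxE.
have tf i : t (f i) ord0 = z i ord0.
  by rewrite tE (big_pred1 i) // => l; rewrite (inj_eq injf).
have Bt : B *m t = B *m x.
  transitivity (colsub f B *m z); last by rewrite /z !mulmxA mulmxV // mul1mx.
  apply/matrixP => a b; rewrite !mxE (ord1 b).
  transitivity (\sum_j \sum_(i | f i == j) B a (f i) * z i ord0).
    apply: eq_bigr => j _; rewrite tE big_distrr /=.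
    by apply: eq_bigr => i /eqP ->.
  rewrite (exchange_big_dep predT) //=; apply: eq_bigr => i _.
  by rewrite (big_pred1 (f i)) ?mxE.
exists t; split.
- by rewrite AE -!mulmxA Bt.
- move=> a aN; rewrite tE big_pred0 // => i; apply: contraNF aN => /eqP <-.
  exact: imset_f.
- move=> a.
  have [/imsetP[i _ ->]|aN] := boolP (a \in [set f i | i in 'I_(\rank A)]).
    rewrite tf mxE (le_trans (ler_norm_sum _ _ _)) //; apply: ler_sum => b _.
    by rewrite normrM ler_piMl.
  rewrite tE big_pred0 ?normr0 ?sumr_ge0 // => i; apply: contraNF aN => /eqP <-.
  exact: imset_f.
Qed.

(** * Iterated Lebesgue integral on tuples *)

Local Open Scope classical_set_scope.
Local Open Scope ring_scope.

Section TupleIntegral.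
Context {R : realType}.
Local Open Scope ereal_scope.

Notation leb := (@lebesgue_measure R).

(** The pushforward under the translation agrees with [leb] on half-open intervals, hence everywhere
    by uniqueness. *)
Lemma lebesgue_integral_shift (f : R -> \bar R) (c : R) :
  measurable_fun setT f -> (forall x, 0 <= f x) ->
  \int[leb]_x f (x + c)%R = \int[leb]_x f x.
Proof.
move=> mf f0.
pose sh := fun x : measurableTypeR R => (x + c)%R : measurableTypeR R.
have mc : measurable_fun setT sh by apply: measurable_funD.
pose nu := pushforward leb sh.
have nuE A : measurable A -> leb A = nu A.
  apply: (@lebesgue_measure_unique R nu) => X /ocitvP[->|[[a b] /= ab ->]].
    by rewrite !measure0.
  rewrite lebesgue_measure_itv/= lte_fin ab /nu /pushforward.
  have -> : sh @^-1` `]a, b]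
     = `](a - c)%R, (b - c)%R]%classic.
    by rewrite /sh; apply/seteqP; split => x /=; rewrite !in_itv/= ltrBlDr lerBrDr.
  rewrite lebesgue_measure_itv/= lte_fin ltrD2r ab -!EFinB; congr _%:E.
  by rewrite opprB addrA subrK.
rewrite -[LHS](@ge0_integral_pushforward _ _ (measurableTypeR R) (measurableTypeR R)
  R sh mc leb setT f)//.
apply: eq_measure_integral => A mA _.
by rewrite [RHS]nuE.
Qed.

(** Integration over R^n as [n] nested one-variable integrals, so that its properties follow from
    dimension one by induction. *)
Fixpoint tint (n : nat) : (n.-tuple R -> \bar R) -> \bar R :=
  match n with
  | 0 => fun F => F [tuple]
  | n'.+1 => fun F => \int[leb]_a tint (fun t => F [tuple of a :: t])
  end.

Lemma tint_ge0 n (F : n.-tuple R -> \bar R) : (forall t, 0 <= F t) -> 0 <= tint F.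
Proof.
elim: n F => [|n IH] F F0 //=.
by apply: integral_ge0 => a _; apply: IH.
Qed.

Lemma eq_tint n (F G : n.-tuple R -> \bar R) : F =1 G -> tint F = tint G.
Proof. by move=> /funext ->. Qed.

(** The parameter space varies in the induction: the outermost variable of integration joins [T]. *)
Lemma measurable_tint d (T : measurableType d) n (F : T * n.-tuple R -> \bar R) :
  measurable_fun setT F -> (forall z, 0 <= F z) ->
  measurable_fun setT (fun x => tint (fun t => F (x, t))).
Proof.
elim: n d T F => [|n IH] d T F mF F0 /=.
  by apply: (measurableT_comp mF); apply: measurable_fun_pair.
pose G (z : T * R) := tint (fun t => F (z.1, [tuple of z.2 :: t])).
have mG : measurable_fun setT G.
  apply: (IH _ _ (fun y : (T * R) * n.-tuple R => F (y.1.1, [tuple of y.1.2 :: y.2]))) => //.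
  apply: (measurableT_comp mF); apply: measurable_fun_pair => /=.
    exact: measurableT_comp.
  apply: measurable_cons => //.
  exact: (measurableT_comp measurable_snd).
apply: (measurable_fun_fubini_tonelli_F (m2 := leb) G mG) => z.
exact: tint_ge0.
Qed.

Lemma measurable_tint_cons n (F : n.+1.-tuple R -> \bar R) :
  measurable_fun setT F -> (forall z, 0 <= F z) ->
  measurable_fun setT (fun a : R => tint (fun t => F [tuple of a :: t])).
Proof.
move=> mF F0.
apply: (measurable_tint (F := fun y : R * n.-tuple R => F [tuple of y.1 :: y.2])) => //.
by apply: (measurableT_comp mF); apply: measurable_cons.
Qed.

Lemma measurable_cons1 n (F : n.+1.-tuple R -> \bar R) a :
  measurable_fun setT F -> measurable_fun setT (fun t : n.-tuple R => F [tuple of a :: t]).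
Proof.
by move=> mF; apply: (measurableT_comp mF); apply: measurable_cons.
Qed.

Lemma le_tint n (F G : n.-tuple R -> \bar R) :
  measurable_fun setT F -> measurable_fun setT G ->
  (forall t, 0 <= F t) -> (forall t, F t <= G t) -> tint F <= tint G.
Proof.
elim: n F G => [|n IH] F G mF mG F0 FG //=.
have G0 t : 0 <= G t by apply: le_trans (FG t).
apply: ge0_le_integral => //=.
- by move=> a _; apply: tint_ge0.
- exact: measurable_tint_cons.
- exact: measurable_tint_cons.
- by move=> a _; apply: IH => //; apply: measurable_cons1.
Qed.

Lemma tint_sum n (I : Type) (s : seq I) (F : I -> n.-tuple R -> \bar R) :
  (forall i, measurable_fun setT (F i)) -> (forall i t, 0 <= F i t) ->
  tint (fun t => \sum_(i <- s) F i t) = \sum_(i <- s) tint (F i).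
Proof.
elim: n F => [|n IH] F mF F0 //=.
rewrite -ge0_integral_sum //.
- by apply: eq_integral => a _; rewrite IH // => i; apply: measurable_cons1.
- by move=> i; apply: measurable_tint_cons.
- by move=> i a _; apply: tint_ge0.
Qed.

Lemma tintZ n (k : R) (F : n.-tuple R -> \bar R) : (0 <= k)%R ->
  measurable_fun setT F -> (forall t, 0 <= F t) ->
  tint (fun t => k%:E * F t) = k%:E * tint F.
Proof.
move=> k0; elim: n F => [|n IH] F mF F0 //=.
rewrite -ge0_integralZl //.
- by apply: eq_integral => a _; rewrite IH //; apply: measurable_cons1.
- exact: measurable_tint_cons.
- by move=> a _; apply: tint_ge0.
Qed.

Lemma tint_shift n (F : n.-tuple R -> \bar R) (c : 'I_n -> R) :
  measurable_fun setT F -> (forall t, 0 <= F t) ->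
  tint (fun t => F [tuple (tnth t i + c i)%R | i < n]) = tint F.
Proof.
elim: n F c => [|n IH] F c mF F0 /=.
  by congr F; apply: tuple0.
rewrite -(lebesgue_integral_shift (c ord0) (measurable_tint_cons mF F0)); last first.
  by move=> a; apply: tint_ge0.
apply: eq_integral => a _.
rewrite -(IH (fun t => F [tuple of (a + c ord0)%R :: t]) (c \o lift ord0)) //; last first.
  exact: measurable_cons1.
apply: eq_tint => t; congr F; apply: eq_from_tnth => i; rewrite tnth_mktuple.
by case: (unliftP ord0 i) => [j ->|->]; rewrite ?tnthS ?tnth0 ?tnth_mktuple.
Qed.

Lemma tint_box n (l u : 'I_n -> R) : (forall i, l i <= u i)%R ->
  tint (fun t => (\prod_(i < n) \1_(`[l i, u i]) (tnth t i))%:E) =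
  (\prod_(i < n) (u i - l i))%R%:E.
Proof.
elim: n l u => [|n IH] l u lu /=; first by rewrite !big_ord0.
have mP : measurable_fun setT (fun t : n.-tuple R =>
   (\prod_(i < n) \1_(`[l (lift ord0 i), u (lift ord0 i)]) (tnth t i) : R)%:E).
  apply/measurable_EFinP; apply: (@measurable_prod _ _ _ _ _ _ (fun i t =>
    \1_(`[l (lift ord0 i), u (lift ord0 i)]) (tnth t i))) => i _.
  by apply: (measurableT_comp (measurable_indic _)) => //; apply: measurable_tnth.
have P0 (t : n.-tuple R) :
    0 <= (\prod_(i < n) \1_(`[l (lift ord0 i), u (lift ord0 i)]) (tnth t i) : R)%:E.
  by rewrite lee_fin; apply: prodr_ge0 => i _; rewrite indicE.
transitivity (\int[leb]_a
    ((\1_(`[l ord0, u ord0]) a)%:E * (\prod_(i < n) (u (lift ord0 i) - l (lift ord0 i)))%R%:E)).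
  apply: eq_integral => a _.
  have i0 : (0 <= \1_(`[l ord0, u ord0]) a :> R)%R by rewrite indicE.
  rewrite -(IH (l \o lift ord0) (u \o lift ord0)) //= -(tintZ i0 mP P0).
  apply: eq_tint => t; rewrite big_ord_recl tnth0 -EFinM; congr (_ * _)%:E.
  by apply: eq_bigr => i _; rewrite tnthS.
rewrite ge0_integralZr //.
- rewrite integral_indic // setIT.
  have lE : leb `[l ord0, u ord0]%classic = (u ord0 - l ord0)%:E.
    rewrite lebesgue_measure_itv /= lte_fin EFinB lt_neqAle lu andbT.
    by case: eqVneq => [->|] //=; rewrite subee.
  by rewrite [X in X * _]lE big_ord_recl EFinM.
- exact/measurable_EFinP.
- by rewrite lee_fin; apply: prodr_ge0 => i _; rewrite subr_ge0.
Qed.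

(** Tonelli, one coordinate at a time. It turns a success probability known for each fixed input
    into an average over inputs for each fixed matrix. *)
Lemma tint_swap d (T : measurableType d) (P : probability T R) n
    (F : T * n.-tuple R -> \bar R) :
  measurable_fun setT F -> (forall z, 0 <= F z) ->
  \int[P]_x tint (fun t => F (x, t)) = tint (fun t => \int[P]_x F (x, t)).
Proof.
elim: n F => [|n IH] F mF F0 //=.
pose G (z : T * R) := tint (fun t => F (z.1, [tuple of z.2 :: t])).
have mG : measurable_fun setT G.
  apply: (@measurable_tint _ _ _ (fun y : (T * R) * n.-tuple R =>
    F (y.1.1, [tuple of y.1.2 :: y.2]))) => //.
  apply: (measurableT_comp mF); apply: measurable_fun_pair => /=.
    exact: measurableT_comp.
  apply: measurable_cons => //.
  exact: (measurableT_comp measurable_snd).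
rewrite (fubini_tonelli (m1 := P) (m2 := leb) G mG) //; last first.
  by move=> z; apply: tint_ge0.
apply: eq_integral => a _; rewrite /G /=.
apply: (IH (fun z => F (z.1, [tuple of a :: z.2]))) => //.
apply: (measurableT_comp mF); apply: measurable_fun_pair => //=.
by apply: measurable_cons => //.
Qed.

End TupleIntegral.

(** * Geometry of the spikes *)

Section Positions.
Variables h q : nat.
Local Open Scope nat_scope.

Definition spike (b j : nat) : nat := b * 2 ^ q.+1 + 2 ^ j.+1.

(** The [minn] sends points beyond the last block to the origin of that block, so that only [h]
    values occur. *)
Definition base (a : nat) : nat := minn (a %/ 2 ^ q.+1) h.-1 * 2 ^ q.+1.

(** With truncated subtraction this is the tent max(0, 2^j - |a - spike b j|), a 1-Lipschitz test
    function for transport. *)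
Definition hat (b j a : nat) : nat := 2 ^ j - ((a - spike b j) + (spike b j - a)).

Lemma spike_div b j : j < q -> spike b j %/ 2 ^ q.+1 = b.
Proof.
move=> jq; rewrite /spike divnMDl ?expn_gt0 // divn_small ?addn0 //.
by rewrite ltn_exp2l.
Qed.

Lemma spike_lt b j : b < h -> j < q -> spike b j < h * 2 ^ q.+1.
Proof. by move=> bh jq; rewrite -ltn_divLR ?expn_gt0 // spike_div. Qed.

Lemma base_le a : base a <= a.
Proof.
apply: leq_trans (leq_divM a (2 ^ q.+1)).
by rewrite /base leq_mul2r geq_minl orbT.
Qed.

Lemma base_lt a : 0 < h -> base a < h * 2 ^ q.+1.
Proof. by move=> h0; rewrite /base ltn_mul2r expn_gt0 /=; lia. Qed.

Lemma base_div a : a %/ 2 ^ q.+1 < h -> base a = a %/ 2 ^ q.+1 * 2 ^ q.+1.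
Proof. by move=> ah; rewrite /base; congr (_ * _); lia. Qed.

Lemma spike_base b j : b < h -> j < q -> spike b j - base (spike b j) = 2 ^ j.+1.
Proof.
by move=> bh jq; rewrite base_div spike_div // /spike addKn.
Qed.

Lemma hat_spike b j : hat b j (spike b j) = 2 ^ j.
Proof. by rewrite /hat subnn subn0. Qed.

(** Within its block the tent lives strictly between 2^j and 3 2^j, and 3 2^j < 2^(q+1) because
    [j < q]. *)
Lemma hat_pos b j a : j < q -> 0 < hat b j a -> a %/ 2 ^ q.+1 = b.
Proof.
move=> jq; rewrite /hat => a0.
have l1 : 2 ^ j.+1 = 2 * 2 ^ j by rewrite expnS.
have l2 : 2 ^ j.+1 <= 2 ^ q by rewrite leq_exp2l.
have l3 : 2 ^ q.+1 = 2 * 2 ^ q by rewrite expnS.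
have l4 : 0 < 2 ^ j by rewrite expn_gt0.
have [l5 l6] : b * 2 ^ q.+1 <= a /\ a < b.+1 * 2 ^ q.+1.
  by rewrite /spike in a0; rewrite mulSn; split; lia.
by apply/eqP; rewrite eqn_leq -ltnS ltn_divLR ?expn_gt0 // l6 leq_divRL ?expn_gt0.
Qed.

Lemma hat_le b j a : b < h -> j < q ->
  hat b j a <= (b == a %/ 2 ^ q.+1) * (a - base a).
Proof.
move=> bh jq; have [->|] := posnP (hat b j a) => // a0.
have ab := hat_pos jq a0; rewrite base_div ?ab // eqxx mul1n.
by move: a0; rewrite /hat /spike (expnS 2 j); lia.
Qed.

(** Positions in a block double from one spike to the next, so every other spike is at distance at
    least 2^j, where the tent has reached 0. *)
Lemma hat_other b j b' j' : j < q -> j' < q -> (b, j) != (b', j') ->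
  hat b j (spike b' j') = 0.
Proof.
move=> jq jq' ne; apply/eqP; rewrite -leqn0 leqNgt; apply/negP => gt0.
have bb := hat_pos jq gt0; rewrite spike_div // in bb; subst b'.
have : j != j' by apply: contraNneq ne => ->.
rewrite neq_ltn => /orP[] lt.
  have : 2 ^ j.+2 <= 2 ^ j'.+1 by rewrite leq_exp2l.
  by move: gt0; rewrite /hat /spike !expnS; lia.
have : 2 ^ j'.+1 <= 2 ^ j by rewrite leq_exp2l.
by move: gt0; rewrite /hat /spike !expnS; lia.
Qed.

Lemma hat_lip (R : realDomainType) b j (a a' : nat) : j < q ->
  (`|(hat b j a)%:R - (hat b j a')%:R| <=
   ((b == a %/ 2 ^ q.+1) + (b == a' %/ 2 ^ q.+1))%N%:R * `|a%:R - a'%:R| :> R)%R.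
Proof.
move=> jq.
have lip : (`|(hat b j a)%:R - (hat b j a')%:R| <= `|a%:R - a'%:R| :> R)%R.
  (* Pass to integers, where [lia] settles the Lipschitz bound with its truncated subtractions. *)
  have -> : (a%:R - a'%:R = (Posz a - Posz a')%:~R :> R)%R by rewrite intrD mulrNz.
  have -> : ((hat b j a)%:R - (hat b j a')%:R = (Posz (hat b j a) - Posz (hat b j a'))%:~R :> R)%R.
    by rewrite intrD mulrNz.
  rewrite -!intr_norm ler_int.
  by rewrite /hat; lia.
have [ab|/eqP nab] := eqVneq b (a %/ 2 ^ q.+1).
  by rewrite (le_trans lip) // ler_peMl // ler1n.
have [ab'|/eqP nab'] := eqVneq b (a' %/ 2 ^ q.+1).
  by rewrite (le_trans lip) // mul1r.
have -> : hat b j a = 0 by apply/eqP; rewrite -leqn0 leqNgt; apply/negP => /(hat_pos jq)/esym.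
have -> : hat b j a' = 0 by apply/eqP; rewrite -leqn0 leqNgt; apply/negP => /(hat_pos jq)/esym.
by rewrite subrr normr0 mul0r.
Qed.

End Positions.

(** * Pairing with tents, and decoding a spike vector from a vector close to it in transport cost *)

Section Spikes.
Variables (R : realType) (h q D : nat).
Hypotheses (h_gt0 : (0 < h)%N) (q_gt0 : (0 < q)%N) (hD : (h * 2 ^ q.+1 <= D)%N).

Notation sym := {ffun 'I_h -> 'I_q}.

Definition spikes (s : sym) : 'cV[R]_D :=
  \col_a \sum_(b < h) (if nat_of_ord a == spike q b (s b) then 2^-1 ^+ (s b).+1 else 0).

(** For non-negative [x], the cost of carrying everything to the block origins; being linear, it
    passes through sums of levels. *)
Definition base_cost (x : 'cV[R]_D) : R := \sum_(a < D) x a ord0 * (a - base h q a)%:R.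

Definition hat_sum (b j : nat) (x : 'cV[R]_D) : R := \sum_(a < D) (hat q b j a)%:R * x a ord0.

Lemma spikes_ge0 s : nonneg_vec (spikes s).
Proof.
move=> a; rewrite mxE; apply: sumr_ge0 => b _; by case: ifP.
Qed.

Lemma spikes_integral (s : sym) (f : nat -> R) :
  \sum_(a < D) spikes s a ord0 * f a = \sum_(b < h) 2^-1 ^+ (s b).+1 * f (spike q b (s b)).
Proof.
under eq_bigr do rewrite mxE big_distrl /=.
rewrite exchange_big /=; apply: eq_bigr => b _.
have ltD : (spike q b (s b) < D)%N by apply: leq_trans hD; apply: spike_lt.
rewrite (bigD1 (Ordinal ltD)) //= eqxx big1 ?addr0 // => a aN.
by case: eqP => [e|_]; rewrite ?mul0r //; case/eqP: aN; apply: val_inj.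
Qed.

Lemma base_cost_spikes s : base_cost (spikes s) = h%:R.
Proof.
rewrite /base_cost (spikes_integral s (fun a => (a - base h q a)%:R)).
transitivity (\sum_(b < h) (1 : R)); last by rewrite sumr_const card_ord.
apply: eq_bigr => b _.
by rewrite spike_base // natrX -exprMn mulVf ?expr1n // pnatr_eq0.
Qed.

Lemma base_costD x y : base_cost (x + y) = base_cost x + base_cost y.
Proof. by rewrite -big_split /=; apply: eq_bigr => a _; rewrite mxE mulrDl. Qed.

Lemma base_costZ c x : base_cost (c *: x) = c * base_cost x.
Proof. by rewrite /base_cost big_distrr /=; apply: eq_bigr => a _; rewrite mxE mulrA. Qed.

Lemma hat_sumD b j x y : hat_sum b j (x + y) = hat_sum b j x + hat_sum b j y.
Proof. by rewrite -big_split /=; apply: eq_bigr => a _; rewrite mxE mulrDr. Qed.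

Lemma hat_sum_ge0 b j x : nonneg_vec x -> 0 <= hat_sum b j x.
Proof. by move=> x0; apply: sumr_ge0 => a _; rewrite mulr_ge0. Qed.

(** The height 2^j times the weight 2^-(j+1) is 1/2 at every scale, so all symbols are equally
    visible. *)
Lemma hat_sum_spikes (s : sym) (b : 'I_h) (j : 'I_q) :
  hat_sum b j (spikes s) = if s b == j then 2^-1 else 0.
Proof.
rewrite /hat_sum; under eq_bigr do rewrite mulrC.
rewrite (spikes_integral s (fun a => (hat q b j a)%:R)) (bigD1 b) //= [X in _ + X]big1 => [|b' bb'].
  rewrite addr0; case: eqP => [->|/eqP ne].
    by rewrite hat_spike natrX exprS -mulrA -exprMn mulVf ?expr1n ?mulr1 // pnatr_eq0.
  by rewrite hat_other ?mulr0 // xpair_eqE eqxx /= eq_sym.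
by rewrite hat_other ?mulr0 // xpair_eqE negb_and eq_sym bb'.
Qed.

(** At each point at most one block has a nonzero tent, and that tent, 1-Lipschitz and zero at the
    block origin, is at most the distance to [base]. *)
Lemma hat_sum_le_base_cost (t : sym) x : nonneg_vec x ->
  \sum_(b < h) hat_sum b (t b) x <= base_cost x.
Proof.
move=> x0; rewrite exchange_big /=; apply: ler_sum => a _.
rewrite -big_distrl /= mulrC; apply: ler_wpM2l => //.
rewrite -natr_sum ler_nat.
apply: (@leq_trans (\sum_(b < h) (nat_of_ord b == a %/ 2 ^ q.+1) * (a - base h q a))%N).
  by apply: leq_sum => b _; apply: hat_le.
rewrite -big_distrl /= -[X in (_ <= X)%N]mul1n leq_mul2r; apply/orP; right.
have [ah|ah] := ltnP (a %/ 2 ^ q.+1) h.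
  rewrite (bigD1 (Ordinal ah)) //= eqxx big1 // => b.
  by rewrite -val_eqE /= => /negbTE ->.
rewrite big1 // => b _; case: eqP => // e.
by move: ah; rewrite -e leqNgt ltn_ord.
Qed.

Lemma sum_block_le2 (a a' : nat) :
  (\sum_(b < h) ((nat_of_ord b == a %/ 2 ^ q.+1) + (nat_of_ord b == a' %/ 2 ^ q.+1)) <= 2)%N.
Proof.
have one c : (\sum_(b < h) (nat_of_ord b == c) <= 1)%N.
  have [ch|ch] := ltnP c h.
    rewrite (bigD1 (Ordinal ch)) //= eqxx big1 // => b.
    by rewrite -val_eqE /= => /negbTE ->.
  by rewrite big1 // => b _; case: eqP => // e; move: ch; rewrite -e leqNgt ltn_ord.
by rewrite big_split /=; apply: (leq_add (one _) (one _)).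
Qed.

(* Hats of distinct blocks have disjoint supports, so a move only changes the
   sums of the blocks of its two ends, hence the factor 2. *)
Lemma hat_sum_transport (t : sym) (x y : 'cV[R]_D) (g : 'M[R]_D) :
  transport_plan x y g ->
  \sum_(b < h) `|hat_sum b (t b) y - hat_sum b (t b) x| <= 2 * transport_cost g.
Proof.
move=> [g0 gx gy].
(* Through the marginals of [g], the difference becomes the change of the tent along each move,
   weighted by the mass moved. *)
have E (b : 'I_h) : hat_sum b (t b) y - hat_sum b (t b) x =
    \sum_(a < D) \sum_(a' < D) g a a' * ((hat q b (t b) a')%:R - (hat q b (t b) a)%:R).
  under [RHS]eq_bigr do under eq_bigr do rewrite mulrBr.
  under [RHS]eq_bigr do rewrite big_split /= sumrN.
  rewrite big_split /= sumrN; congr (_ - _).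
    rewrite exchange_big /=; apply: eq_bigr => a _.
    by rewrite -big_distrl /= gy mulrC.
  by apply: eq_bigr => a _; rewrite -big_distrl /= gx mulrC.
apply: (@le_trans _ _ (\sum_(b < h) \sum_(a < D) \sum_(a' < D)
   g a a' * `|(hat q b (t b) a)%:R - (hat q b (t b) a')%:R|)).
  apply: ler_sum => b _; rewrite E.
  apply: (le_trans (ler_norm_sum _ _ _)); apply: ler_sum => a _.
  apply: (le_trans (ler_norm_sum _ _ _)); apply: ler_sum => a' _.
  by rewrite normrM (ger0_norm (g0 _ _)) distrC.
rewrite exchange_big /= /transport_cost big_distrr /=; apply: ler_sum => a _.
rewrite exchange_big /= big_distrr /=; apply: ler_sum => a' _.
rewrite -big_distrr /= [leRHS]mulrCA; apply: ler_wpM2l => //.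
apply: (@le_trans _ _ (\sum_(b < h)
   ((nat_of_ord b == a %/ 2 ^ q.+1) + (nat_of_ord b == a' %/ 2 ^ q.+1))%N%:R * `|a%:R - a'%:R|)).
  by apply: ler_sum => b _; apply: hat_lip.
rewrite -big_distrl /= -natr_sum; apply: ler_wpM2r => //.
by rewrite ler_nat; apply: sum_block_le2.
Qed.

(** In each block the tent with the largest pairing wins; [q_gt0] provides the starting index of the
    maximum. *)
Definition spike_decode (x : 'cV[R]_D) : sym :=
  [ffun b => [arg max_(j > Ordinal q_gt0) hat_sum (nat_of_ord b) (nat_of_ord j) x]%O].

Lemma decode_max x (b : 'I_h) (j : 'I_q) : hat_sum b j x <= hat_sum b (spike_decode x b) x.
Proof.
rewrite /spike_decode ffunE.
by case: arg_maxP => // i _ /(_ j isT).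
Qed.

Definition errors (s t : sym) : nat := #|[pred b | s b != t b]|.

(** In a wrong block the true tent sees at least 1/2 in [spikes s + r] and the decoded one sees only
    [r], yet [x] ranks them the other way. So [r] and the two discrepancies caused by transport add
    up to at least 1/2; sum over the blocks. *)
Lemma errors_transport (s : sym) (r x : 'cV[R]_D) g : nonneg_vec r ->
  transport_plan x (spikes s + r) g ->
  (errors (spike_decode x) s)%:R <= 8 * transport_cost g + 2 * base_cost r.
Proof.
move=> r0 tp; set t := spike_decode x; set y := spikes s + r.
have cs := hat_sum_transport s tp; have ct := hat_sum_transport t tp.
have cr := hat_sum_le_base_cost t r0.
rewrite -/y in cs ct.
suff H : (errors t s)%:R * 2^-1 <= \sum_(b < h) hat_sum b (t b) r +
    \sum_(b < h) `|hat_sum b (s b) y - hat_sum b (s b) x| +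
    \sum_(b < h) `|hat_sum b (t b) y - hat_sum b (t b) x| by lra.
rewrite -!big_split /= /errors -sum1_card natr_sum big_distrl /=.
rewrite [leRHS](bigID (fun b => b \in [pred b | t b != s b])) /=.
apply: ler_wpDr; first by apply: sumr_ge0 => b _; rewrite !addr_ge0 // hat_sum_ge0.
apply: ler_sum => b; rewrite inE => ne; rewrite mul1r.
have := decode_max x b (s b); rewrite -/t => le.
have ys : 2^-1 <= hat_sum b (s b) y.
  by rewrite hat_sumD hat_sum_spikes eqxx lerDl hat_sum_ge0.
have yt : hat_sum b (t b) y = hat_sum b (t b) r.
  by rewrite hat_sumD hat_sum_spikes eq_sym (negbTE ne) add0r.
have := ler_norm (hat_sum b (s b) y - hat_sum b (s b) x).
have := ler_norm (- (hat_sum b (t b) y - hat_sum b (t b) x)); rewrite normrN.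
rewrite yt; lra.
Qed.

(** Leave the spikes in place and carry [r] to the block origins: the result lives on [h] spikes and
    [h] origins. *)
Lemma best_sparse_error_spikes (k : nat) (s : sym) (r : 'cV[R]_D) :
  (2 * h <= k)%N -> nonneg_vec r ->
  (best_sparse_error k (spikes s + r) <= (base_cost r)%:E)%E.
Proof.
move=> hk r0.
have D_gt0 : (0 < D)%N by apply: leq_trans hD; rewrite muln_gt0 h_gt0 expn_gt0.
pose g : 'M[R]_D := \matrix_(a, b) ((if a == b then spikes s a ord0 else 0) +
  (if nat_of_ord b == base h q a then r a ord0 else 0)).
have g0 a b : 0 <= g a b.
  by rewrite mxE addr_ge0 //; case: ifP => // _; apply: spikes_ge0.
have baseD a : (base h q a < D)%N by apply: leq_trans hD; apply: base_lt.
pose x' : 'cV[R]_D := \col_b \sum_a g a b.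
have rowg a : \sum_b g a b = (spikes s + r) a ord0.
  under eq_bigr do rewrite mxE.
  rewrite big_split /= -big_mkcond (big_pred1 a) => [|b]; last by rewrite /= eq_sym.
  rewrite [RHS]mxE; congr (_ + _).
  rewrite (bigD1 (Ordinal (baseD a))) //= eqxx big1 ?addr0 // => b bN.
  by case: eqP => // e; case/eqP: bN; apply: val_inj.
have tp : transport_plan (spikes s + r) x' g.
  by split=> // b; rewrite mxE.
apply: (@le_trans _ _ (EMD (spikes s + r) x')).
  apply: ereal_inf_lbound; exists x' => //; split.
  - by move=> b; rewrite mxE sumr_ge0.
  - apply: leq_trans hk; rewrite mul2n -addnn.
    (* Enumerates the possible support; all these positions are below [D], so the default of
       [insubd] never occurs. *)
    pose F (z : 'I_h + 'I_h) : 'I_D := match z with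
      | inl b => insubd (Ordinal D_gt0) (spike q b (s b))
      | inr b => insubd (Ordinal D_gt0) (b * 2 ^ q.+1)%N end.
    apply: (@leq_trans #|codom F|).
      apply: subset_leq_card; apply/fintype.subsetP => b; rewrite inE => bN.
      apply: contraNT bN => bF; rewrite mxE big1 // => a _.
      have nF z : b != F z by apply: contraNneq bF => ->; apply: codom_f.
      rewrite mxE; case: eqP => [ab|_].
        rewrite mxE big1 ?add0r => [|i _]; last first.
          case: eqP => // e; case/eqP: (nF (inl i)); apply: val_inj.
          have sD : (spike q i (s i) < D)%N by apply: leq_trans hD; apply: spike_lt.
          by rewrite /= insubdK // -ab.
        case: eqP => // e; exfalso.
        have mh : (minn (a %/ 2 ^ q.+1) h.-1 < h)%N by lia.
        case/eqP: (nF (inr (Ordinal mh))); apply: val_inj.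
        by rewrite /= insubdK //; apply: baseD.
      rewrite add0r; case: eqP => // e; exfalso.
      have mh : (minn (a %/ 2 ^ q.+1) h.-1 < h)%N by lia.
      case/eqP: (nF (inr (Ordinal mh))); apply: val_inj.
      by rewrite /= insubdK //; apply: baseD.
    by rewrite (leq_trans (leq_image_card _ _)) // card_sum !card_ord.
  - rewrite /mass; under eq_bigr do rewrite mxE.
    by rewrite exchange_big /=; apply: eq_bigr => a _; rewrite rowg.
apply: ereal_inf_lbound; exists g => //; congr _%:E.
apply: eq_bigr => a _.
under eq_bigr do rewrite mxE mulrDl.
rewrite big_split /= big1 ?add0r => [|b _]; last first.
  by case: eqP => [->|_]; rewrite ?subrr ?normr0 ?mulr0 ?mul0r.
rewrite (bigD1 (Ordinal (baseD a))) //= eqxx big1 ?addr0 => [|b bN]; last first.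
  by case: eqP => [e|_]; rewrite ?mul0r //; case/eqP: bN; apply: val_inj.
by rewrite -natrB ?base_le // normr_nat.
Qed.

Lemma good_recovery_errors (k : nat) (K : R) (s : sym) (r x : 'cV[R]_D) :
  (2 * h <= k)%N -> 0 < K -> nonneg_vec r ->
  good_recovery k K (spikes s + r) x ->
  (errors (spike_decode x) s)%:R <= (8 * K + 2) * base_cost r.
Proof.
move=> hk K0 r0 good.
suff : ((((errors (spike_decode x) s)%:R - 2 * base_cost r) / 8)%:E <= (K * base_cost r)%:E)%E.
  rewrite lee_fin; lra.
(* [EMD] is an infimum, so it suffices to bound the cost of each plan from below; this also covers
   the absence of plans. *)
apply: (@le_trans _ _ (EMD x (spikes s + r))).
  apply: le_ereal_inf_tmp => _ [g tp <-]; rewrite lee_fin.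
  have := errors_transport r0 tp; lra.
apply: (le_trans good); rewrite EFinM lee_wpmul2l //; last exact: best_sparse_error_spikes.
by rewrite lee_fin ltW.
Qed.

End Spikes.

(** * Successive decoding and volumes *)

Section Levels.
Variables (R : realType) (h q n : nat).
Notation sym := {ffun 'I_h -> 'I_q}.
Variables (y : sym -> 'cV[R]_n) (delta : R).
Hypothesis delta_gt0 : 0 < delta.

(** Horner form: subtracting the first symbol and rescaling leaves the input of the tail of the
    list. *)
Fixpoint levels (ss : seq sym) (x : 'cV[R]_n) : 'cV[R]_n :=
  if ss is s :: ss' then y s + delta *: levels ss' x else x.

Lemma levels_affine ss x : levels ss x = levels ss 0 + delta ^+ size ss *: x.
Proof.
elim: ss => [|s ss IH] /=; first by rewrite add0r scale1r.
by rewrite IH scalerDr addrA scalerA exprS.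
Qed.

Lemma levels_ge0 ss x : (forall s, nonneg_vec (y s)) -> nonneg_vec x ->
  nonneg_vec (levels ss x).
Proof.
move=> y0 x0; elim: ss => [|s ss IH] //= a; rewrite !mxE.
by apply: addr_ge0; [exact: y0 | apply: mulr_ge0; [exact: ltW | exact: IH]].
Qed.

(** A geometric series of ratio at most 1/2. It is stated for a linear functional because both
    [base_cost] and [mass] are needed. *)
Lemma levels_le (phi : 'cV[R]_n -> R) (B : R) ss x :
  (forall u v, phi (u + v) = phi u + phi v) -> (forall c u, phi (c *: u) = c * phi u) ->
  0 <= B -> delta <= 2^-1 -> (forall s, phi (y s) <= B) -> phi x <= 2 * B ->
  phi (levels ss x) <= 2 * B.
Proof.
move=> phiD phiZ B0 d2 yB xB; elim: ss => [|s ss IH] //=.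
rewrite phiD phiZ.
have : delta * phi (levels ss x) <= delta * (2 * B) by rewrite ler_wpM2l // ltW.
have : delta * (2 * B) <= 2^-1 * (2 * B) by rewrite ler_wpM2r // mulr_ge0.
have := yB s; lra.
Qed.

Section Decoding.
Variables (m : nat) (A : 'M[R]_(m, n)) (dec : 'cV[R]_m -> sym).

(* Errors of the successive decoding in which the true symbols of the previous
   levels are revealed and subtracted. *)
Fixpoint wrong (v : 'cV[R]_m) (ss : seq sym) : nat :=
  if ss is s :: ss' then (errors (dec v) s + wrong (delta^-1 *: (v - A *m y s)) ss')%N else 0.

(** A level costs at most h/2 errors if its input is good and at most [h] otherwise. By linearity
    the residual measurement is that of the next input. *)
Lemma wrong_levels (good : 'cV[R]_n -> bool) ss x :
  (forall s ss', good (levels (s :: ss') x) ->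
     2 * errors (dec (A *m levels (s :: ss') x)) s <= h)%N ->
  (2 * wrong (A *m levels ss x) ss <=
   (size ss + \sum_(i < size ss) ~~ good (levels (drop i ss) x)) * h)%N.
Proof.
move=> H; elim: ss => [|s ss IH] //.
have -> : (\sum_(i < size (s :: ss)) ~~ good (levels (drop i (s :: ss)) x) =
    ~~ good (levels (s :: ss) x) + \sum_(i < size ss) ~~ good (levels (drop i ss) x))%N.
  by rewrite [LHS]big_ord_recl.
rewrite [wrong _ _]/= [size (s :: ss)]/=.
have -> : delta^-1 *: (A *m levels (s :: ss) x - A *m y s) = A *m levels ss x.
  by rewrite /= mulmxDr addrC addKr -scalemxAr scalerA mulVf ?scale1r // gt_eqF.
have le1 : (2 * errors (dec (A *m levels (s :: ss) x)) s <=
    (1 + ~~ good (levels (s :: ss) x)) * h)%N.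
  case: (boolP (good _)) => [g|_] /=; first by rewrite addn0 mul1n H.
  by rewrite leq_mul2l /= (leq_trans (max_card _)) // card_ord.
rewrite mulnDr; apply: leq_trans (leq_add le1 IH) _.
by rewrite -mulnDl leq_mul2r; apply/orP; right; lia.
Qed.

(** The weight is a product over blocks, each contributing 1 for the right symbol and [z] for each
    of the q - 1 others. *)
Lemma sum_errors (s : sym) (z : R) :
  \sum_(t : sym) z ^+ errors s t = (1 + q.-1%:R * z) ^+ h.
Proof.
transitivity (\sum_(t : sym) \prod_(b < h) (if s b != t b then z else 1)).
  apply: eq_bigr => t _.
  by rewrite -big_mkcond /= /errors prodr_const.
rewrite -(bigA_distr_bigA (fun b (j : 'I_q) => if s b != j then z else 1)) /=.
transitivity (\prod_(b < h) (1 + q.-1%:R * z)); last by rewrite prodr_const card_ord.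
apply: eq_bigr => b _.
rewrite (bigD1 (s b)) //= eqxx /=; congr (_ + _).
rewrite (eq_bigr (fun=> z)) => [|j jb]; last by rewrite eq_sym jb.
rewrite sumr_const mulr_natl; congr (_ *+ _).
by rewrite cardC1 card_ord.
Qed.

Lemma big_tuple_cons (S : finType) (r : nat) (F : r.+1.-tuple S -> R) :
  \sum_t F t = \sum_(s : S) \sum_(t : r.-tuple S) F [tuple of s :: t].
Proof.
rewrite pair_bigA /=.
rewrite (reindex (fun p : S * r.-tuple S => [tuple of p.1 :: p.2])) //=.
exists (fun t => (thead t, [tuple of behead t])) => [[s t]|t] _ /=.
  by congr pair; apply: val_inj.
by rewrite [RHS]tuple_eta.
Qed.

(** The guess at a level depends only on [v] and the earlier symbols, so levels can be summed one by
    one, uniformly in [v]; with z = 1/q each gives at most 2^h. *)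
Lemma sum_wrong (v : 'cV[R]_m) (r : nat) : (0 < q)%N ->
  \sum_(ss : r.-tuple sym) q%:R^-1 ^+ wrong v ss <= 2 ^+ (r * h) :> R.
Proof.
move=> q0; elim: r v => [|r IH] v.
  rewrite (big_pred1 [tuple]) => [|t]; first by [].
  by rewrite [t]tuple0 /= eqxx.
rewrite big_tuple_cons mulSn exprD.
apply: (@le_trans _ _ (\sum_(s : sym) (q%:R^-1 : R) ^+ errors (dec v) s * 2 ^+ (r * h))).
  apply: ler_sum => s _ /=; under eq_bigr do rewrite exprD.
  by rewrite -big_distrr /= ler_wpM2l ?exprn_ge0.
rewrite -big_distrl /= sum_errors; apply: ler_wpM2r; first by rewrite exprn_ge0.
apply: lerXn2r; rewrite ?nnegrE ?addr_ge0 ?mulr_ge0 //.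
rewrite (_ : 2 = 1 + 1) // lerD2l ler_pdivrMr ?ltr0n // mul1r ler_nat leq_pred //.
Qed.

(** Exponential Markov: each string counted contributes at least q^-e to the sum in [sum_wrong]. *)
Lemma card_wrong_le (v : 'cV[R]_m) (r e : nat) : (0 < q)%N ->
  #|[pred ss : r.-tuple sym | (wrong v ss <= e)%N]|%:R <= q%:R ^+ e * 2 ^+ (r * h) :> R.
Proof.
move=> q0; rewrite mulrC -ler_pdivrMr ?exprn_gt0 ?ltr0n //.
apply: le_trans (sum_wrong v r q0).
rewrite -sum1_card natr_sum big_distrl /=.
rewrite [leRHS](bigID [pred ss : r.-tuple sym | (wrong v ss <= e)%N]) /=.
apply: ler_wpDr; first by apply: sumr_ge0 => ss _; rewrite exprn_ge0.
apply: ler_sum => ss; rewrite inE => le; rewrite mul1r -exprVn.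
by apply: ler_wiXn2l => //; rewrite ?invr_ge0 // invf_le1 ?ltr0n // ler1n.
Qed.

End Decoding.
End Levels.

(** * Volumes in the unit cube: overlaps of translates, and averages of failures *)

Section Volume.
Context {R : realType}.

Definition vec n (u : n.-tuple R) : 'cV[R]_n := \col_a tnth u a.

Definition cube n : set (n.-tuple R) := [set u | forall a, 0 <= tnth u a <= 1].

Lemma indic_cube n (u : n.-tuple R) :
  \1_(@cube n) u = \prod_(a < n) \1_(`[0, 1]) (tnth u a) :> R.
Proof.
rewrite indicE; case: (boolP (u \in _)) => [/set_mem cu|/negP nu].
  rewrite big1 // => a _; rewrite indicE mem_set //=.
  by rewrite in_itv /= cu.
apply/esym/eqP; rewrite prodf_seq_eq0; apply/hasP.
have [a na] : exists a, ~ (0 <= tnth u a <= 1).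
  by apply/existsNP => cu; apply: nu; apply: mem_set.
exists a; rewrite ?mem_index_enum //= indicE memNset //=.
Qed.

Lemma measurable_box n (l u : 'I_n -> R) :
  measurable_fun setT (fun t : n.-tuple R => \prod_(a < n) \1_(`[l a, u a]) (tnth t a) : R).
Proof.
apply: (@measurable_prod _ _ _ _ _ _ (fun i t => \1_(`[l i, u i]) (tnth t i))) => i _.
by apply: (measurableT_comp (measurable_indic _)) => //; apply: measurable_tnth.
Qed.

Lemma measurable_cube n : measurable (@cube n).
Proof.
apply/(@measurable_indicP _ _ R); apply: eq_measurable_fun (measurable_box (fun=> 0) (fun=> 1)).
by move=> u _; rewrite indic_cube.
Qed.

Lemma tint_cube n : tint (fun u : n.-tuple R => (\1_(@cube n) u)%:E) = 1%E.
Proof.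
transitivity (tint (fun t : n.-tuple R => (\prod_(i < n) \1_(`[0, 1]) (tnth t i))%:E : \bar R)).
  by apply: eq_tint => t; rewrite indic_cube.
by rewrite (tint_box (l := fun=> 0) (u := fun=> 1)) // subr0 big1.
Qed.

(* Each [E i] is translated inside the fibres of [A], so that a point covered by
   several translates has a single image under [A]. *)
Lemma volume_bound (m n : nat) (A : 'M[R]_(m, n)) (I : finType)
    (E : I -> set (n.-tuple R)) (c : I -> 'cV[R]_n) (N B rho : R) :
  0 < rho -> 0 <= B -> (forall i, measurable (E i)) -> (forall i, E i `<=` @cube n) ->
  (forall i, \sum_b `|c i b ord0| <= B) ->
  (forall v, #|[pred i | `[< exists2 u, E i u & v = A *m (c i + rho *: vec u) >]]|%:R <= N) ->
  (\sum_i tint (fun u => (\1_(E i) u)%:E) <= (N * (2 * (B / rho) + 1) ^+ m)%:E)%E.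
Proof.
move=> rho0 B0 mE Ec cB cN.
have N0 : 0 <= N by apply: le_trans (cN 0).
have [S Sm Sx] := bounded_sparse_preimage A.
have tex i : exists x : 'cV[R]_n, [/\ A *m x = A *m c i,
    forall a, a \notin S -> x a ord0 = 0 & forall a, `|x a ord0| <= B].
  by have [x [x1 x2 x3]] := Sx (c i); exists x; split => // a; apply: le_trans (cB i).
have [t tP] := choice tex.
set T := B / rho; have T0 : 0 <= T by rewrite divr_ge0 // ltW.
pose tau i a := - (t i a ord0 / rho).
have mi i : measurable_fun setT (fun u : n.-tuple R => (\1_(E i) u)%:E : \bar R).
  by apply/measurable_EFinP; apply: measurable_indic.
pose F i (z : n.-tuple R) : \bar R := (\1_(E i) [tuple (tnth z a + tau i a)%R | a < n])%:E.
have mF i : measurable_fun setT (F i).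
  apply: (measurableT_comp (mi i)); apply/measurable_fun_tnthP => a.
  rewrite (_ : _ \o _ = fun z : n.-tuple R => tnth z a + tau i a); last first.
    by apply/funext => z /=; rewrite tnth_mktuple.
  by apply: measurable_funD => //; apply: measurable_tnth.
have F0 i z : (0 <= F i z)%E by rewrite lee_fin indicE.
under eq_bigr => i _.
  rewrite -(tint_shift (tau i) (mi i)); last by move=> u; rewrite lee_fin indicE.
  over.
rewrite -(tint_sum _ mF F0).
pose l (a : 'I_n) := if a \in S then - T else 0.
pose u (a : 'I_n) := if a \in S then T + 1 else 1.
have lu a : l a <= u a by rewrite /l /u; case: ifP => _; lra.
(* All translates lie in one box, long only in the directions of [S], and each point lies in at most
   [N] of them. *)
apply: (@le_trans _ _ (tint (fun z : n.-tuple R =>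
  N%:E * (\prod_(a < n) \1_(`[l a, u a]) (tnth z a))%:E)%E)).
  apply: le_tint.
  - by apply: emeasurable_sum.
  - by apply: measurable_funeM; apply/measurable_EFinP; apply: measurable_box.
  - by move=> z; apply: sume_ge0.
  move=> z; rewrite sumEFin -EFinM lee_fin.
  have [[i Ei]|nE] := pselect (exists i, E i [tuple (tnth z a + tau i a)%R | a < n]).
    have -> : \prod_(a < n) \1_(`[l a, u a]) (tnth z a) = 1 :> R.
      apply: big1 => a _; rewrite indicE mem_set //= in_itv /=.
      have [_ t0 tB] := tP i.
      have := Ec _ _ Ei a; rewrite tnth_mktuple /tau /l /u.
      case: ifP => [_|/negbT aS]; last by rewrite t0 // mul0r oppr0 addr0.
      have : `|t i a ord0 / rho| <= T.
        by rewrite normrM (gtr0_norm (x := rho^-1)) ?invr_gt0 // ler_wpM2r // invr_ge0 ltW.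
      rewrite ler_norml; lra.
    (* Since [t j] and [c j] have the same image, every translate through [z] yields this same
       measurement vector. *)
    rewrite mulr1; apply: le_trans (cN (rho *: (A *m vec z))).
    rewrite -sum1_card natr_sum [leRHS]big_mkcond /=; apply: ler_sum => j _.
    rewrite indicE inE; case: (boolP (_ \in E j)) => [/set_mem Ej|_]; last by case: ifP.
    case: asboolP => // nE; exfalso; apply: nE.
    exists [tuple (tnth z a + tau j a)%R | a < n] => //.
    have [At _ _] := tP j.
    rewrite mulmxDr -At -mulmxDr scalemxAr; congr (_ *m _).
    apply/matrixP => a b; rewrite !mxE tnth_mktuple (ord1 b) /tau; field.
    by rewrite gt_eqF.
  rewrite big1 => [|i _].
    by rewrite mulr_ge0 // prodr_ge0 // => a _; rewrite indicE.
  by rewrite indicE memNset // => Ei; apply: nE; exists i.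
rewrite tintZ //; first last.
- by move=> z; rewrite lee_fin prodr_ge0 // => a _; rewrite indicE.
- by apply/measurable_EFinP; apply: measurable_box.
rewrite tint_box // -EFinM lee_fin ler_wpM2l //.
apply: (@le_trans _ _ ((2 * T + 1) ^+ #|S|)).
  rewrite (bigID (fun a => a \in S)) /= [X in _ * X]big1 => [|a /negbTE aS]; last first.
    by rewrite /l /u aS subr0.
  rewrite mulr1 (eq_bigr (fun=> 2 * T + 1)) => [|a aS]; last by rewrite /l /u aS; lra.
  by rewrite prodr_const.
by apply: ler_weXn2l => //; lra.
Qed.

Lemma measurable_cube_snd d (T : measurableType d) n :
  measurable [set wu : T * n.-tuple R | @cube n wu.2].
Proof.
rewrite -[X in measurable X]setTI.
by apply: (@measurable_snd _ _ T (n.-tuple R)) => //; apply: measurable_cube.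
Qed.

Lemma measurable_few_failures d (T : measurableType d) (n p r : nat)
    (G : 'I_r -> set (T * n.-tuple R)) :
  (forall i, measurable (G i)) ->
  measurable [set wu | @cube n wu.2 /\ (\sum_(i < r) ~~ `[< G i wu >] <= p)%N].
Proof.
move=> mG; rewrite (_ : [set _ | _] = [set wu : T * n.-tuple R | @cube n wu.2] `&`
    ((fun wu => \sum_(i < r) \1_(~` G i) wu : R) @^-1` [set` `]-oo, p%:R]])); last first.
  apply/seteqP; split => wu /=; rewrite in_itv /=;
    rewrite (_ : \sum_(i < r) \1_(~` G i) wu = (\sum_(i < r) ~~ `[< G i wu >])%:R :> R) ?ler_nat //;
    by rewrite natr_sum; apply: eq_bigr => i _; rewrite indicE in_setC.
apply: measurableI; first exact: measurable_cube_snd.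
rewrite -[X in measurable X]setTI.
apply: measurable_sum => // i; apply: measurable_indic; exact: measurableC.
Qed.

(* Markov's inequality for the number of failures. *)
Lemma half_successes d (T : measurableType d) (P : probability T R) (n p : nat)
    (G : 'I_(p + p) -> set (T * n.-tuple R)) :
  (0 < p)%N -> (forall i, measurable (G i)) ->
  (forall i u, @cube n u -> ((3 / 4)%:E <= P [set w | G i (w, u)])%E) ->
  (2^-1%:E <= \int[P]_w tint (fun u => (\1_([set wu | @cube n wu.2 /\
     (\sum_(i < p + p) ~~ `[< G i wu >] <= p)%N]) (w, u))%:E))%E.
Proof.
move=> p0 mG GP; set H := [set wu | _].
have mH : measurable H by apply: measurable_few_failures.
pose B i := [set wu : T * n.-tuple R | @cube n wu.2] `&` ~` G i.
have mB i : measurable (B i).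
  by apply: measurableI; [exact: measurable_cube_snd | exact: measurableC].
pose S (j : 'I_p + 'I_(p + p)) := match j with inl _ => H | inr i => B i end.
have mS j : measurable (S j) by case: j.
have mI j : measurable_fun setT (fun wu => (\1_(S j) wu)%:E : \bar R).
  by apply/measurable_EFinP; apply: measurable_indic.
have I0 j wu : (0 <= (\1_(S j) wu)%:E :> \bar R)%E by rewrite lee_fin indicE.
have mIw j w : measurable_fun setT (fun u => (\1_(S j) (w, u))%:E : \bar R).
  by apply: (measurableT_comp (mI j)); apply: measurable_fun_pair.
have mcubeE : measurable_fun setT (fun u : n.-tuple R => (\1_(@cube n) u)%:E : \bar R).
  by apply/measurable_EFinP; apply: measurable_indic; apply: measurable_cube.
(* After exchanging the integrals, [u] is fixed and the failure probability is at most 1/4. *)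
have bad i : (\int[P]_w tint (fun u => (\1_(B i) (w, u))%:E) <= (1 / 4)%:E)%E.
  rewrite (tint_swap P (mI (inr i)) (I0 (inr i))).
  have -> : ((1 / 4)%:E =
      tint (fun u : n.-tuple R => (1 / 4)%:E * (\1_(@cube n) u)%:E) :> \bar R)%E.
    by rewrite tintZ ?tint_cube ?mule1 //.
  apply: le_tint.
  - exact: (measurable_fun_fubini_tonelli_G (m1 := P) _ (mI (inr i)) (I0 (inr i))).
  - exact: measurable_funeM.
  - by move=> u; apply: integral_ge0 => w _; apply: (I0 (inr i)).
  move=> u /=; rewrite indicE; case: (boolP (u \in _)) => [/set_mem cu|/negP nu].
    rewrite mule1 (eq_integral (fun w => (\1_(~` [set w | G i (w, u)]) w)%:E))
      => [|w _]; last first.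
      rewrite !indicE; congr (_ %:R %:E); congr nat_of_bool.
      by apply/idP/idP => /set_mem h; apply: mem_set; [case: h | split].
    have mGu : measurable [set w | G i (w, u)].
      by have := measurable_ysection u (mG i); rewrite ysectionE.
    rewrite integral_indic ?setIT; [|exact: measurableT|exact: measurableC].
    rewrite [leLHS](_ : _ = (1 - P [set w | G i (w, u)])%E); last exact: probability_setC.
    rewrite leeBlDr; last exact: fin_num_measure.
    have := GP i u cu; rewrite -(@fineK _ (P [set w | G i (w, u)])); last exact: fin_num_measure.
    by rewrite -EFinD !lee_fin => ?; lra.
  rewrite mulr0n mule0 integral0_eq // => w _; rewrite indicE memNset // => -[cu _].
  by apply: nu; apply: mem_set.
(* Pointwise on the cube, either [H] holds and its [p] copies give [p], or more than [p] failures
   do. Integrated, this reads p <= p J + 2p/4, with [J] the integral for [H]. *)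
have main : (p%:R%:E <= \sum_j \int[P]_w tint (fun u => (\1_(S j) (w, u))%:E))%E.
  rewrite -ge0_integral_sum //; first last.
  - by move=> j w _; apply: tint_ge0.
  - by move=> j; apply: (measurable_tint (F := fun wu => (\1_(S j) wu)%:E)).
  have -> : (p%:R%:E = \int[P]_w p%:R%:E)%E.
    rewrite integral_cst // [X in (_ * X)%E](_ : _ = 1%E) ?mule1 //.
    exact: probability_setT.
  apply: ge0_le_integral => //.
  - apply: emeasurable_sum => j.
    exact: (measurable_tint (F := fun wu => (\1_(S j) wu)%:E)).
  move=> w _; rewrite -tint_sum //.
  have -> : (p%:R%:E = tint (fun u : n.-tuple R => p%:R%:E * (\1_(@cube n) u)%:E) :> \bar R)%E.
    by rewrite tintZ ?tint_cube ?mule1 // => u; rewrite lee_fin indicE.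
  apply: le_tint.
  - exact: measurable_funeM.
  - exact: emeasurable_sum.
  - by move=> u; rewrite -EFinM lee_fin indicE mulr_ge0.
  move=> u; rewrite sumEFin -EFinM lee_fin indicE.
  case: (boolP (u \in _)) => [/set_mem cu|_]; last first.
    by rewrite mulr0 sumr_ge0 // => j _; rewrite indicE.
  rewrite mulr1 big_sumType /= sumr_const card_ord.
  have [le|gt] := leqP (\sum_(i < p + p) ~~ `[< G i (w, u) >])%N p.
    rewrite indicE mem_set //; apply: ler_wpDr => //.
    by apply: sumr_ge0 => i _; rewrite indicE.
  apply: ler_wpDl; first by rewrite mulrn_wge0 // indicE.
  rewrite (eq_bigr (fun i => (~~ `[< G i (w, u) >])%:R)) => [|i _].
    by rewrite -natr_sum ler_nat ltnW.
  rewrite indicE; congr _%:R; congr nat_of_bool.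
  apply/idP/negP => [/set_mem[_ nG] /asboolP //|nG].
  by apply: mem_set; split => // Gi; apply: nG; apply/asboolP.
move: main; rewrite big_sumType /=.
set J := (\int[P]_w _)%E => main.
have J0 : (0 <= J)%E.
  by apply: integral_ge0 => w _; apply: tint_ge0 => u; apply: (I0 (inl (Ordinal p0))).
have : (p%:R%:E <= \sum_(i < p) J + \sum_(i < p + p) (1 / 4)%:E)%E.
  by apply: le_trans main _; rewrite leeD2l //; apply: lee_sum => i _; apply: bad.
have sc (r : R) (l : nat) : (\sum_(i < l) r%:E = (l%:R * r)%:E)%E.
  by rewrite sumEFin sumr_const card_ord mulr_natl.
rewrite sc.
move: J J0 {main} => [r| |] //; last by move=> *; rewrite leey.
move=> _; rewrite sc -EFinD !lee_fin natrD => le.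
have p1 : 0 < p%:R :> R by rewrite ltr0n.
rewrite -(ler_pM2l p1); lra.
Qed.

End Volume.

(** * The lower bound *)

Lemma expr_bounded_le1 (R : realType) (x C : R) :
  0 <= x -> (forall t : nat, (0 < t)%N -> x ^+ t <= C) -> x <= 1.
Proof.
move=> x0 xC; rewrite leNgt; apply/negP => x1.
have bern t : 1 + t%:R * (x - 1) <= x ^+ t.
  elim: t => [|t IH]; first by rewrite mul0r addr0.
  rewrite exprS -natr1.
  have : x * (1 + t%:R * (x - 1)) <= x * x ^+ t by rewrite ler_wpM2l.
  have : 0 <= t%:R * ((x - 1) * (x - 1)) :> R by rewrite mulr_ge0 // mulr_ge0 // subr_ge0 ltW.
  lra.
pose t := Num.bound `|C / (x - 1)|.
have Ct : C / (x - 1) < t.+1%:R.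
  apply: lt_le_trans (_ : t%:R <= _); last by rewrite ler_nat.
  by rewrite (le_lt_trans (ler_norm _)) // archi_boundP.
have := xC t.+1 isT; have := bern t.+1.
move: Ct; rewrite ltr_pdivrMr ?subr_gt0 //; lra.
Qed.

(** Letting t grow removes the constant, and with it all dependence on the noise scale. *)
Lemma expr_le_limit (R : realType) (a b C : R) : 0 <= a -> 0 < b ->
  (forall t : nat, (0 < t)%N -> a ^+ t <= C * b ^+ t) -> a <= b.
Proof.
move=> a0 b0 H; rewrite -[leRHS]mul1r -ler_pdivrMr //.
apply: (@expr_bounded_le1 _ _ C); first by rewrite divr_ge0 // ltW.
by move=> t /H; rewrite expr_div_n ler_pdivrMr // exprn_gt0.
Qed.

Lemma level_count_split (t h : nat) : (h * (2 * t + 2 * t) = 3 * t * h + h * t)%N.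
Proof. lia. Qed.

Lemma level_count_mul (t h : nat) : ((2 * t + 2 * t) * h = 4 * (h * t))%N.
Proof. lia. Qed.

Lemma error_budget (t h : nat) :
  ((2 * t + 2 * t + 2 * t) * h <= 2 * (3 * t * h))%N.
Proof. lia. Qed.

Section Scheme.
Variables (R : realType) (h q D : nat).
Hypotheses (h_gt0 : (0 < h)%N) (q_gt0 : (0 < q)%N) (hD : (h * 2 ^ q.+1 <= D)%N).
Notation sym := {ffun 'I_h -> 'I_q}.

Lemma mass_spikes (s : sym) : mass (spikes R D s) <= h%:R.
Proof.
rewrite /mass; under eq_bigr do rewrite -[_ _ ord0]mulr1.
rewrite (spikes_integral hD s (fun=> 1)).
apply: (@le_trans _ _ (\sum_(b < h) (1 : R))); last by rewrite sumr_const card_ord.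
by apply: ler_sum => b _; rewrite mulr1 exprn_ile1 // invf_le1 // ler1n.
Qed.

Variables (k m : nat) (K : R) (d : measure_display) (T : measurableType d)
  (P : probability T R) (A : T -> 'M[R]_(m, D)) (rec : T -> 'cV[R]_m -> 'cV[R]_D).
Hypotheses (hk : (2 * h <= k)%N) (K1 : 1 <= K)
  (scheme : linear_sparse_recovery_scheme k K P A rec).

Let delta : R := (40 * K)^-1.
(** At most [D] noise coordinates, each at most 1 and moved by at most [D]: after this scaling the
    noise has [base_cost] at most 1. *)
Let eta : R := (D%:R ^+ 2)^-1.
Let x (ss : seq sym) (u : D.-tuple R) := levels (spikes R D) delta ss (eta *: vec u).
Let good (w : T) (v : 'cV[R]_D) : bool := `[< good_recovery k K v (rec w (A w *m v)) >].

Let D_gt0 : (0 < D)%N.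
Proof. by apply: leq_trans hD; rewrite muln_gt0 h_gt0 expn_gt0. Qed.

Let eta_gt0 : 0 < eta. Proof. by rewrite invr_gt0 exprn_gt0 // ltr0n. Qed.
Let K_gt0 : 0 < K. Proof. exact: lt_le_trans K1. Qed.
Let delta_gt0 : 0 < delta. Proof. by rewrite invr_gt0 mulr_gt0. Qed.
Let delta_le : delta <= 2^-1.
Proof. by move: K1 => K1'; rewrite lef_pV2 ?posrE ?mulr_gt0 //; lra. Qed.

Let noise_ge0 u : @cube R D u -> nonneg_vec (eta *: vec u).
Proof.
by move=> cu a; rewrite !mxE mulr_ge0 ?(ltW eta_gt0) //; have /andP[] := cu a.
Qed.

Let x_ge0 ss u : @cube R D u -> nonneg_vec (x ss u).
Proof.
move=> cu; apply: levels_ge0 => //; last exact: noise_ge0.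
by move=> s; apply: spikes_ge0.
Qed.

Let noise_cost u : @cube R D u -> base_cost h q (eta *: vec u) <= 2 * h%:R.
Proof.
move=> cu; rewrite base_costZ.
have le : base_cost h q (vec u) <= D%:R ^+ 2.
  apply: (@le_trans _ _ (\sum_(a < D) (D%:R : R))).
    apply: ler_sum => a _; rewrite mxE.
    have /andP[u0 u1] := cu a.
    rewrite -[leRHS]mul1r; apply: ler_pM => //.
    by rewrite ler_nat (leq_trans (leq_subr _ _)) // ltnW.
  by rewrite sumr_const card_ord expr2 mulr_natl.
apply: (@le_trans _ _ (eta * D%:R ^+ 2)); first by rewrite ler_wpM2l // ltW.
rewrite mulVf; last by rewrite expf_neq0 // pnatr_eq0 -lt0n.
have : 1 <= h%:R :> R by rewrite ler1n.
lra.
Qed.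

Let x_cost ss u : @cube R D u -> base_cost h q (x ss u) <= 2 * h%:R.
Proof.
move=> cu; apply: levels_le => //.
- exact: base_costD.
- exact: base_costZ.
- by move=> s; rewrite base_cost_spikes.
- exact: noise_cost.
Qed.

(** The later levels have [base_cost] at most 2 delta h, and 8K + 2 <= 10K; with delta = 1/(40K) the
    errors are at most h/2. *)
Let good_errors w s ss u : @cube R D u -> good w (x (s :: ss) u) ->
  (2 * errors (spike_decode h q_gt0 (rec w (A w *m x (s :: ss) u))) s <= h)%N.
Proof.
move=> cu /asboolP gd.
have r0 : nonneg_vec (delta *: x ss u).
  by move=> a; rewrite mxE mulr_ge0 ?(ltW delta_gt0) //; apply: x_ge0.
have K1' := K1.
have := good_recovery_errors h_gt0 q_gt0 hD hk K_gt0 r0 gd.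
set er := errors _ _ => le; rewrite -(ler_nat R) natrM.
rewrite base_costZ in le.
have l1 : delta * base_cost h q (x ss u) <= delta * (2 * h%:R).
  by rewrite ler_wpM2l ?(ltW delta_gt0) // x_cost.
have l2 : (8 * K + 2) * (delta * base_cost h q (x ss u)) <= (10 * K) * (delta * (2 * h%:R)).
  apply: ler_pM => //; try lra.
  rewrite mulr_ge0 ?(ltW delta_gt0) //; apply: sumr_ge0 => a _; rewrite mulr_ge0 //.
  exact: x_ge0.
have : (10 * K) * (delta * (2 * h%:R)) = 2^-1 * h%:R.
  by rewrite /delta; field; rewrite gt_eqF.
lra.
Qed.

(** The input is an affine function of the noise, so the joint measurability in the scheme can be
    pulled back. *)
Let measurable_good (ss : seq sym) :
  measurable [set wu : T * D.-tuple R | good wu.1 (x ss wu.2)].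
Proof.
have [mM _] := scheme.
pose phi (wu : T * D.-tuple R) : T * D.-tuple R :=
  (wu.1, [tuple x ss wu.2 a ord0 | a < D]).
have mphi : measurable_fun setT phi.
  apply: measurable_fun_pair => //; apply/measurable_fun_tnthP => a.
  rewrite (_ : _ \o _ = fun wu : T * D.-tuple R =>
    levels (spikes R D) delta ss 0 a ord0 + delta ^+ size ss * (eta * tnth wu.2 a)); last first.
    by apply/funext => wu /=; rewrite tnth_mktuple /x levels_affine !mxE.
  apply: measurable_funD => //; apply: measurable_funM => //; apply: measurable_funM => //.
  by apply: (measurableT_comp (measurable_tnth _)).
have := mphi measurableT _ mM; rewrite setTI.
congr measurable; apply/seteqP; split => -[w u] /=.
  by move=> gd; apply/asboolP; move: gd; rewrite (_ : \col_a _ = x ss u) //;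
    apply/matrixP => a b; rewrite mxE tnth_mktuple (ord1 b).
by move/asboolP; rewrite (_ : \col_a _ = x ss u) //;
  apply/matrixP => a b; rewrite mxE tnth_mktuple (ord1 b).
Qed.

(** With 4t levels and at most 2t failures, at most 3th symbols are wrong. Each of the q^(4th)
    strings keeps on average half the cube, while for each matrix the total volume is at most
    multiplicity times box. *)
Let level_bound (t : nat) : (0 < t)%N ->
  ((q%:R ^+ h) ^+ (2 * t + 2 * t)) * 2^-1 <=
  (q%:R ^+ (3 * t * h) * 2 ^+ ((2 * t + 2 * t) * h)) *
  (2 * (2 * h%:R / (delta ^+ (2 * t + 2 * t) * eta)) + 1) ^+ m :> R.
Proof.
move=> t0; set p := (2 * t)%N.
have p0 : (0 < p)%N by rewrite muln_gt0.
(* Each tail is itself a non-negative input, so the guarantee of 3/4 applies at every level. *)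
pose G (ss : (p + p).-tuple sym) (i : 'I_(p + p)) :=
  [set wu : T * D.-tuple R | good wu.1 (x (drop i ss) wu.2)].
have GP ss i u : @cube R D u -> ((3 / 4)%:E <= P [set w | G ss i (w, u)])%E.
  move=> cu; have [_ /(_ _ (x_ge0 (drop i ss) cu))] := scheme.
  congr (_ <= P _)%E; apply/seteqP; split => w /=; first by move/asboolP.
  by move=> gd; apply/asboolP.
pose H ss := [set wu : T * D.-tuple R | @cube R D wu.2 /\
     (\sum_(i < p + p) ~~ `[< G ss i wu >] <= p)%N].
have mG (ss : (p + p).-tuple sym) i : measurable (G ss i) by apply: measurable_good.
have half ss := half_successes p0 (mG ss) (GP ss).
have mH ss : measurable (H ss) by apply: measurable_few_failures.
set M := (X in _ <= X).
have M0 : 0 <= M.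
  rewrite !mulr_ge0 ?exprn_ge0 // addr_ge0 // !mulr_ge0 // invr_ge0.
  by rewrite mulr_ge0 ?exprn_ge0 // ltW.
have vol w : (\sum_ss tint (fun u => (\1_(H ss) (w, u))%:E) <= M%:E)%E.
  apply: (volume_bound (A := A w) (E := fun ss => [set u | H ss (w, u)])
    (c := fun ss : (p + p).-tuple sym => levels (spikes R D) delta ss 0)).
  - by rewrite mulr_gt0 // exprn_gt0.
  - by rewrite mulr_ge0.
  - by move=> ss; have := measurable_xsection w (mH ss); rewrite xsectionE.
  - by move=> ss u [].
  - move=> ss; rewrite (eq_bigr (fun b => levels (spikes R D) delta ss 0 b ord0)) => [|b _].
      apply: (@levels_le R h q D (spikes R D) delta delta_gt0 (@mass R D)) => //.
      + by move=> u v; rewrite /mass -big_split; apply: eq_bigr => b _; rewrite mxE.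
      + by move=> c u; rewrite /mass big_distrr; apply: eq_bigr => b _; rewrite mxE.
      + exact: mass_spikes.
      + by rewrite /mass big1 ?mulr_ge0 // => b _; rewrite mxE.
    rewrite ger0_norm //; apply: levels_ge0 => //; first by move=> s; apply: spikes_ge0.
    by move=> a; rewrite mxE.
  move=> v; pose dec y := spike_decode h q_gt0 (rec w y).
  apply: le_trans (card_wrong_le (spikes R D) delta (A w) dec v (p + p) (3 * t * h) q_gt0).
  rewrite ler_nat; apply: subset_leq_card; apply/fintype.subsetP => ss.
  move=> /asboolP[u [cu few] ->].
  suff : (wrong (spikes R D) delta (A w) dec (A w *m x ss u) ss <= 3 * t * h)%N.
    by rewrite /x levels_affine size_tuple scalerA.
  rewrite /x.
  have := @wrong_levels R h q D (spikes R D) delta delta_gt0 m (A w) dec (good w) ss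
    (eta *: vec u) (fun s ss' => @good_errors w s ss' u cu).
  rewrite size_tuple; move: few.
  rewrite (eq_bigr (fun i : 'I_(p + p) => nat_of_bool (~~ good w (x (drop i ss) u))))
    => [few le|i _]; last first.
    by rewrite asboolb.
  rewrite -(leq_pmul2l (isT : 0 < 2)%N); apply: (leq_trans le).
  by rewrite (leq_trans (leq_mul (leq_add (leqnn _) few) (leqnn h))) // error_budget.
have mt ss : measurable_fun setT (fun w => tint (fun u => (\1_(H ss) (w, u))%:E)).
  apply: (measurable_tint (F := fun wu => (\1_(H ss) wu)%:E)).
    by apply/measurable_EFinP; apply: measurable_indic.
  by move=> wu; rewrite lee_fin indicE.
have t0' ss w : (0 <= tint (fun u => (\1_(H ss) (w, u))%:E))%E.
  by apply: tint_ge0 => u; rewrite lee_fin indicE.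
have : (\sum_(ss : (p + p).-tuple sym) (2^-1)%:E <= M%:E)%E.
  apply: (@le_trans _ _ (\sum_ss \int[P]_w tint (fun u => (\1_(H ss) (w, u))%:E))%E).
    by apply: lee_sum => ss _; apply: half.
  rewrite -ge0_integral_sum //.
  apply: (@le_trans _ _ (\int[P]_w M%:E)%E).
    apply: ge0_le_integral => //.
    - by move=> w _; apply: sume_ge0.
    - exact: emeasurable_sum.
  rewrite integral_cst // [X in (_ * X)%E](_ : _ = 1%E) ?mule1 //.
  exact: probability_setT.
rewrite sumEFin lee_fin sumr_const card_tuple card_ffun !card_ord => le.
by apply: le_trans le; rewrite -[leRHS]mulr_natl !natrX.
Qed.

Lemma scheme_bound : q%:R ^+ h <= 16 ^+ h * (40 * K) ^+ (4 * m) :> R.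
Proof.
have K0 : 0 < 40 * K by rewrite mulr_gt0.
have K1' := K1.
(* Collects every factor independent of [t]. *)
pose C : R := 2 * (2 * (2 * h%:R / eta) + 1) ^+ m.
apply: (@expr_le_limit _ _ _ C); first by rewrite exprn_ge0.
  by rewrite mulr_gt0 // exprn_gt0.
move=> t t0; have := level_bound t0.
have q0 : 0 < q%:R ^+ (3 * t * h) :> R by rewrite exprn_gt0 // ltr0n.
have -> : (q%:R ^+ h) ^+ (2 * t + 2 * t) = q%:R ^+ (3 * t * h) * (q%:R ^+ h) ^+ t :> R.
  by rewrite -!exprM -exprD level_count_split.
rewrite -!mulrA ler_pM2l // ler_pdivrMr // => le; apply: (le_trans le).
have -> : 2 ^+ ((2 * t + 2 * t) * h) = (16 ^+ h) ^+ t :> R.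
  have -> : 16 = 2 ^+ 4 :> R by rewrite -natrX.
  by rewrite -!exprM level_count_mul ?mulnA.
have X0 : 0 <= 2 * (2 * h%:R / (delta ^+ (2 * t + 2 * t) * eta)) + 1.
  by rewrite addr_ge0 // !mulr_ge0 // invr_ge0 mulr_ge0 ?exprn_ge0 // ltW.
have D1 : 1 <= (40 * K) ^+ (2 * t + 2 * t) by rewrite exprn_ege1 //; lra.
have le1 : 2 * (2 * h%:R / (delta ^+ (2 * t + 2 * t) * eta)) + 1 <=
    (2 * (2 * h%:R / eta) + 1) * (40 * K) ^+ (2 * t + 2 * t).
  have -> : 2 * (2 * h%:R / (delta ^+ (2 * t + 2 * t) * eta)) =
      2 * (2 * h%:R / eta) * (40 * K) ^+ (2 * t + 2 * t).
    by rewrite /delta exprVn invfM invrK -!mulrA [_ * eta^-1]mulrC.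
  by rewrite [leRHS]mulrDl mul1r lerD2l.
have le2 : (2 * (2 * h%:R / (delta ^+ (2 * t + 2 * t) * eta)) + 1) ^+ m <=
    (2 * (2 * h%:R / eta) + 1) ^+ m * ((40 * K) ^+ (4 * m)) ^+ t.
  have -> : ((40 * K) ^+ (4 * m)) ^+ t = ((40 * K) ^+ (2 * t + 2 * t)) ^+ m.
    by rewrite -!exprM level_count_mul ?mulnA.
  by rewrite -exprMn; apply: lerXn2r; rewrite ?nnegrE // (le_trans X0).
rewrite exprMn /C.
have p16 : 0 <= (16 ^+ h) ^+ t :> R by rewrite !exprn_ge0.
have := ler_wpM2l p16 le2; rewrite -!mulrA; lra.
Qed.
End Scheme.

(** * Choice of [h] and [q], and the final estimate *)

Lemma half_bounds (k : nat) : (1 < k)%N ->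
  [/\ (0 < k./2)%N, (k./2 <= k)%N, (2 * k./2 <= k)%N & (k <= 3 * k./2)%N].
Proof. by split; lia. Qed.

(** Take q + 1 to be the integer part of the logarithm and use 2 <= e; the loss of 2 comes from the
    rounding and the shift. *)
Lemma block_exponent (R : realType) (k Delta : nat) : (0 < k)%N -> (0 < Delta)%N ->
  2 <= ln (Delta%:R / k%:R) :> R ->
  exists2 q : nat, (k * 2 ^ q.+1 <= Delta)%N & ln (Delta%:R / k%:R) - 2 <= q%:R :> R.
Proof.
move=> k0 D0; set tau := ln _ => tau2.
have tau0 : 0 <= tau by lra.
have Dk : 0 < Delta%:R / k%:R :> R by rewrite divr_gt0 // ltr0n.
have /andP[le1 le2] := truncn_itv tau0.
have : (1 < Num.truncn tau)%N.
  by rewrite -ltnS -(ltr_nat R); apply: le_lt_trans le2.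
case: (Num.truncn tau) le1 le2 => [|q] // le1 le2 _.
exists q; last by move: le2; rewrite -addn2 natrD; lra.
rewrite -(ler_nat R) natrM natrX mulrC -ler_pdivlMr ?ltr0n //.
apply: (@le_trans _ _ (expR 1 ^+ q.+1)).
  by apply: lerXn2r; rewrite ?nnegrE ?expR_ge0 // (le_trans _ (expR_ge1Dx 1)) //; lra.
by rewrite -expRM_natr mul1r -[leRHS](@lnK R) ?posrE // ler_expR.
Qed.

Theorem mainTheorem13 (R : realType) (K0 : R) (hK0 : 1 < K0) :
  exists c1 c2 : R, 0 < c1 /\ 0 < c2 /\
    forall (k Delta m : nat) (K : R)
      (d : measure_display) (T : measurableType d) (P : probability T R)
      (A : T -> 'M[R]_(m, Delta)) (rec : T -> 'cV[R]_m -> 'cV[R]_Delta),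
      (1 < k)%N -> (1 <= Delta)%N -> K0 <= K ->
      linear_sparse_recovery_scheme k K P A rec ->
      c1 * k%:R * ln (c2 * ln (Delta%:R / k%:R)) / ln K <= m%:R.
Proof.
have lK0 : 0 < ln K0 by rewrite ln_gt0.
have l40 : 0 < ln (40 : R) by rewrite ln_gt0 // ltr1n.
(* As K >= K0 > 1, the constant ln 40 is at most (ln 40 / ln K0) ln K, so ln (40 K) <= L ln K. *)
pose L := 1 + ln 40 / ln K0.
have L0 : 0 < L by rewrite addr_gt0 // divr_gt0.
(* 12 is 3 from k <= 3h times 4 from the exponent 4m; 1/32 works since q >= tau - 2 gives q/16 >=
   tau/32 once tau >= 4. *)
exists (12 * L)^-1, 32^-1; split; first by rewrite invr_gt0 mulr_gt0.
split; first by rewrite invr_gt0.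
move=> k Delta m K d T P A rec k1 D1 KK0 scheme.
have K1 : 1 < K by apply: lt_le_trans KK0.
have lK : 0 < ln K by rewrite ln_gt0.
set tau := ln (_ / _); rewrite ler_pdivrMr //.
(* In the small case the outer logarithm is at most 0 and the bound is trivial; otherwise tau >
   32. *)
have [small|big] := leP (32^-1 * tau) 1.
  apply: (@le_trans _ _ 0); last by rewrite mulr_ge0 // ltW.
  by rewrite mulr_ge0_le0 ?ln_le0 // mulr_ge0 // invr_ge0 mulr_ge0 // ltW.
have tau2 : 2 <= tau by lra.
have [q qD qtau] := block_exponent (ltnW k1) D1 tau2.
have q0 : (0 < q)%N by rewrite -(ltr_nat R); rewrite -/tau in qtau; lra.
have [h0 hle hk hk3] := half_bounds k1.
have hD : (k./2 * 2 ^ q.+1 <= Delta)%N.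
  by apply: leq_trans qD; rewrite leq_mul2r hle orbT.
have := scheme_bound h0 q0 hD hk (ltW K1) scheme.
have qR0 : 0 < q%:R :> R by rewrite ltr0n.
have K40 : 0 < 40 * K by rewrite mulr_gt0 // (lt_trans ltr01).
move=> scale.
have bound : (q%:R / 16) ^+ k./2 <= (40 * K) ^+ (4 * m).
  by rewrite expr_div_n ler_pdivrMr ?exprn_gt0 // mulrC.
have lnb : k./2%:R * ln (q%:R / 16) <= 4 * m%:R * ln (40 * K).
  have : ln ((q%:R / 16) ^+ k./2) <= ln ((40 * K) ^+ (4 * m)).
    by rewrite ler_ln // posrE exprn_gt0 // divr_gt0.
  rewrite !lnXn ?divr_gt0 // -[X in X <= _]mulr_natl -[X in _ <= X]mulr_natl.
  by rewrite natrM.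
have Kp : 0 < K by apply: lt_trans K1.
have K0p : 0 < K0 by apply: lt_trans hK0.
have ln40K : ln (40 * K) <= L * ln K.
  have -> : ln (40 * K) = ln 40 + ln K by rewrite lnM // posrE.
  have le1 : 1 <= ln K / ln K0.
    by rewrite ler_pdivlMr // mul1r ler_ln // posrE.
  have := ler_wpM2l (ltW l40) le1; rewrite mulr1.
  by rewrite /L mulrDl mul1r [_ * ln K]mulrAC -mulrA => ?; rewrite addrC lerD2l.
have lntau : ln (32^-1 * tau) <= ln (q%:R / 16).
  rewrite ler_ln ?posrE ?divr_gt0 //; last by apply: lt_trans big.
  rewrite -/tau in qtau; lra.
have lntau0 : 0 <= ln (32^-1 * tau) by rewrite ln_ge0 // ltW.
have k3 : k%:R <= 3 * k./2%:R :> R by rewrite -natrM ler_nat.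
have s1 : k%:R * ln (32^-1 * tau) <= 3 * k./2%:R * ln (q%:R / 16).
  exact: ler_pM.
have s2 : 4 * m%:R * ln (40 * K) <= 4 * m%:R * (L * ln K).
  by rewrite ler_wpM2l // mulr_ge0.
rewrite -mulrA ler_pdivrMl ?mulr_gt0 //; lra.
Qed.
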